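(* Let $G$ be a topological group and let $X$ be a homogeneous binary $G$-space. Then $X$ is a topologically homogeneous space, i.e. for any two points $x,y\in X$ there exists a homeomorphism $\varphi : X\to X$ with $\varphi(x)=y$.
   Context: A binary action of a topological group $G$ on a topological space $X$ is a continuous map $\mu : G\times X\times X\to X$, written $\mu(g,x,y)=g(x,y)$, such that $gh(x,y)=g(x,h(x,y))$ and $e(x,y)=y$ for all $g,h\in G$, $x,y\in X$, where $e$ is the identity of $G$. The triple $(G,X,\mu)$ (or just $X$) is then called a binary $G$-space. For $A\subset X$ put $G(A,A)=\{g(a_1,a_2): g\in G,\ a_1,a_2\in A\}$. A subset $A\subset X$ is bi-invariant if $G(A,A)=A$. The orbit $[x]$ of $x\in X$ is the minimal bi-invariant subset of $X$ containing $x$. A binary $G$-space $X$ is homogeneous if there is a point $x\in X$ with $[x]=X$. *)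

(* Defs.v *)
From HB Require Import structures.
From mathcomp Require Import all_boot.
From mathcomp Require Import boolp classical_sets topology.

Set Implicit Arguments.
Unset Strict Implicit.
Unset Printing Implicit Defensive.

Local Open Scope classical_set_scope.
Local Open Scope group_scope.

(* Not assumed commutative nor Hausdorff. *)
HB.mixin Record isTopologicalGroup G & Group G & Topological G := {
  mulg_continuous : continuous (fun p : G * G => p.1 * p.2);
  invg_continuous : continuous (fun g : G => g^-1)
}.

#[short(type="topologicalGroupType")]
HB.structure Definition TopologicalGroup :=
  {G of Group G & Topological G & isTopologicalGroup G}.

(* [mu g x y] stands for g(x,y); continuity is joint, for the product topology
   on G * X * X. *)
Record binary_action (G : topologicalGroupType) (X : topologicalType) := {
  binary_act :> G -> X -> X -> X;
  binary_act_continuous :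
    continuous (fun p : G * X * X => binary_act p.1.1 p.1.2 p.2);
  binary_actM : forall (g h : G) (x y : X),
    binary_act (g * h) x y = binary_act g x (binary_act h x y);
  binary_act1 : forall x y : X, binary_act 1 x y = y
}.

Section BinaryGSpace.
Variables (G : topologicalGroupType) (X : topologicalType).
Variable mu : binary_action G X.

(* G(A,A) *)
Definition binary_saturation (A : set X) : set X :=
  \bigcup_(g in [set: G]) [set mu g a1 a2 | a1 in A & a2 in A].

Definition bi_invariant (A : set X) : Prop := binary_saturation A = A.

(* [smallest] is an intersection, taken over all bi-invariant sets containing x;
   [bi_invariant_orbit] and [binary_orbit_minimal] show that it is bi-invariant
   and is the only minimal bi-invariant set containing x. *)
Definition binary_orbit (x : X) : set X := smallest bi_invariant [set x].

Definition binary_homogeneous : Prop :=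
  exists x : X, binary_orbit x = [set: X].

Lemma bi_invariantP (A : set X) :
  bi_invariant A <-> forall g a1 a2, A a1 -> A a2 -> A (mu g a1 a2).
Proof.
split=> [invA g a1 a2 Aa1 Aa2|AA].
  by rewrite -invA; exists g => //; exists a1 => //; exists a2.
apply/seteqP; split=> [_ [g _ [a1 Aa1 [a2 Aa2 <-]]]|a Aa]; first exact: AA.
by exists 1 => //; exists a => //; exists a => //; rewrite binary_act1.
Qed.

Lemma binary_orbit_refl (x : X) : binary_orbit x x.
Proof. by move=> A [_]; apply. Qed.

Lemma bi_invariant_orbit (x : X) : bi_invariant (binary_orbit x).
Proof.
apply/bi_invariantP => g a1 a2 oa1 oa2 A [invA xA].
by have /bi_invariantP := invA; apply; [exact: oa1|exact: oa2].
Qed.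

Lemma binary_orbit_minimal (x : X) (A : set X) :
  A = binary_orbit x <->
  [/\ bi_invariant A, A x &
    forall B : set X, bi_invariant B -> B x -> B `<=` A -> B = A].
Proof.
split=> [->|[invA Ax minA]].
  split; [exact: bi_invariant_orbit|exact: binary_orbit_refl|].
  move=> B invB Bx BA; apply/seteqP; split=> // y; apply.
  by split=> // _ ->.
apply/esym/minA; [exact: bi_invariant_orbit|exact: binary_orbit_refl|].
by move=> y; apply; split=> // _ ->.
Qed.

End BinaryGSpace.

Definition homeomorphism (X Y : topologicalType) (phi : X -> Y) : Prop :=
  continuous phi /\
  exists psi : Y -> X, [/\ continuous psi, cancel phi psi & cancel psi phi].

Definition topologically_homogeneous (X : topologicalType) : Prop :=
  forall x y : X, exists phi : X -> X, homeomorphism phi /\ phi x = y.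

(* Main.v *)
Require Import Defs.
From mathcomp Require Import all_boot.
From mathcomp Require Import boolp classical_sets topology.

(** Fixing the first argument of a binary action leaves an ordinary action:
    every [mu g a] is a homeomorphism of [X], with inverse [mu g^-1 a]
    ([homeomorphism_binary_act]). Hence [mu g a b] always lies in the orbit of
    [b] under the homeomorphism group of [X], whatever [a] is, so each orbit of
    that group is bi-invariant ([bi_invariant_homeo_orbit]). The binary orbit of
    a point [z], being the least bi-invariant set containing [z], is therefore
    contained in its orbit under homeomorphisms ([binary_orbit_sub_homeo]). When
    the binary orbit of [z] is all of [X], homeomorphisms carry [z] to any
    point, and composing them carries any point to any other. *)

Set Implicit Arguments.
Unset Strict Implicit.
Unset Printing Implicit Defensive.

Local Open Scope classical_set_scope.
Local Open Scope group_scope.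

Lemma homeomorphism_id (X : topologicalType) : homeomorphism (@id X).
Proof.
by split; [|exists id; split=> //] => x; exact: cvg_id.
Qed.

Lemma homeomorphism_comp (X Y Z : topologicalType) (f : X -> Y) (g : Y -> Z) :
  homeomorphism f -> homeomorphism g -> homeomorphism (g \o f).
Proof.
move=> [cf [f' [cf' fK f'K]]] [cg [g' [cg' gK g'K]]].
split; first by move=> x; apply: continuous_comp; [exact: cf|exact: cg].
exists (f' \o g'); split; [|exact: can_comp|exact: can_comp].
by move=> z; apply: continuous_comp; [exact: cg'|exact: cf'].
Qed.

Lemma homeomorphism_inv (X Y : topologicalType) (f : X -> Y) :
  homeomorphism f ->
  exists f' : Y -> X, homeomorphism f' /\ cancel f f'.
Proof.
move=> [cf [f' [cf' fK f'K]]]; exists f'; split=> //.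
by split=> //; exists f; split.
Qed.

Section BinaryAction.
Variables (G : topologicalGroupType) (X : topologicalType).
Variable mu : binary_action G X.

Lemma continuous_binary_act (g : G) (a : X) : continuous (mu g a).
Proof.
move=> x.
have cpair : continuous (fun y : X => ((g, a), y)).
  move=> y; apply: (@cvg_pair _ _ _ _ (nbhs (g, a)) (nbhs y)).
    exact: cvg_cst.
  exact: cvg_id.
exact: (continuous_comp (cpair x) (@binary_act_continuous _ _ mu (g, a, x))).
Qed.

(** The action laws only multiply in the group while the first point stays put,
    so [g^-1] with the same [a] undoes [g]. *)
Lemma homeomorphism_binary_act (g : G) (a : X) : homeomorphism (mu g a).
Proof.
split; first exact: continuous_binary_act.
exists (mu g^-1 a); split; first exact: continuous_binary_act.
- by move=> x; rewrite -binary_actM mulVg binary_act1.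
- by move=> x; rewrite -binary_actM mulgV binary_act1.
Qed.

(** Membership of the second argument alone already forces [mu g a b] into the
    orbit, since [mu g a] is itself a homeomorphism. *)
Lemma bi_invariant_homeo_orbit (z : X) :
  bi_invariant mu [set y | exists phi : X -> X, homeomorphism phi /\ phi z = y].
Proof.
apply/bi_invariantP => g a _ _ [phi [hphi <-]].
exists (mu g a \o phi); split=> //.
exact: (homeomorphism_comp hphi (homeomorphism_binary_act g a)).
Qed.

Lemma binary_orbit_sub_homeo (z : X) :
  binary_orbit mu z `<=`
  [set y | exists phi : X -> X, homeomorphism phi /\ phi z = y].
Proof.
move=> y; apply; split; first exact: bi_invariant_homeo_orbit.
by move=> _ ->; exists id; split=> //; exact: homeomorphism_id.
Qed.

End BinaryAction.

Theorem theorem3 (G : topologicalGroupType) (X : topologicalType)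
    (mu : binary_action G X) (hX : binary_homogeneous mu) :
  topologically_homogeneous X.
Proof.
case: hX => z oz x y.
have from_z w : exists phi : X -> X, homeomorphism phi /\ phi z = w.
  by apply: (@binary_orbit_sub_homeo _ _ mu); rewrite oz.
have [phi [hphi <-]] := from_z x; have [psi [hpsi <-]] := from_z y.
have [phi' [hphi' phiK]] := homeomorphism_inv hphi.
exists (psi \o phi'); split; first exact: homeomorphism_comp.
by rewrite /= phiK.
Qed.
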